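(* Let $Z_1\subset\mathbb{R}^5$ be the set of points $(x_1,x_2,y,z,w)$ with $x_1,x_2,y,w\in\mathbb{R}$, $z\in\{0,1\}$ and $$q_2x_2^2+ry^2+z\le w,\quad x_2=ax_1+by+cz,\quad gz\le y\le hz,\quad \ell_1\le x_1\le u_1,\quad \ell_2\le x_2\le u_2. \qquad ( * )$$ Then the convex hull of $Z_1$ is the set of all $(x_1,x_2,y,z,w)\in\mathbb{R}^5$ with $z\in[0,1]$ that satisfy $( * )$ and for which there exists $p\in\mathbb{R}$ such that $$w\ \ge\ q_2\Big(\frac1z-1\Big)(x_2-ap)^2+q_2x_2^2+z+\frac{ry^2}{z},$$ $$\ell_1\le p\le u_1,\qquad \frac{x_1-u_1z}{1-z}\le p\le\frac{x_1-\ell_1z}{1-z},$$ $$\ell_2\le ap\le u_2,\qquad \frac{x_2-u_2z}{1-z}\le ap\le\frac{x_2-\ell_2z}{1-z}.$$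
   Context: The data are real numbers $a,b,c,g,h,\ell_1,u_1,\ell_2,u_2$ and $q_2,r\ge 0$. The set $Z_1$ is the feasible set of the epigraph form of a single-period hybrid control problem with one-dimensional state, control and binary mode variables. Convention for the endpoints $z\in\{0,1\}$. At $z=0$ (where $( * )$ forces $y=0$ and the displayed bounds force $p=x_1$, $ap=x_2$) the first displayed inequality is read as $w\ge q_2x_2^2$. At $z=1$ the first displayed inequality is read as $w\ge q_2x_2^2+ry^2+1$ and the conditions on $p$ are void (they correspond to conditions on $(1-z)p$, which vanishes at $z=1$). *)

(* Defs.v *)
From mathcomp Require Import all_boot all_order all_algebra.
From mathcomp Require Import boolp classical_sets reals convex.

Set Implicit Arguments.
Unset Strict Implicit.
Unset Printing Implicit Defensive.

Import Order.TTheory GRing.Theory Num.Theory.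
Local Open Scope classical_set_scope.
Local Open Scope ring_scope.

Definition convex_hull (R : numDomainType) (M : lmodType R) (A : set M)
    : set M :=
  smallest (@convex_set R M) A.

Definition system1 (R : realType)
    (a b c g h l1 u1 l2 u2 q2 r x1 x2 y z w : R) : Prop :=
  [/\ q2 * x2 ^+ 2 + r * y ^+ 2 + z <= w,
      x2 = a * x1 + b * y + c * z,
      g * z <= y <= h * z,
      l1 <= x1 <= u1 &
      l2 <= x2 <= u2].

(* In 'rV[R]_5 the columns 0, 1, 2, 3, 4 hold x1, x2, y, z, w; the numerals
   are elements of the ring structure of 'I_5. *)
Definition Z1 (R : realType) (a b c g h l1 u1 l2 u2 q2 r : R)
    : set 'rV[R]_5 :=
  [set v | (v 0 3 = 0 \/ v 0 3 = 1) /\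
     system1 a b c g h l1 u1 l2 u2 q2 r
       (v 0 0) (v 0 1) (v 0 2) (v 0 3) (v 0 4)].

(* At z = 0 the expression containing 1 / z is replaced by q2 * x2 ^+ 2.
   At z = 1 no convention is needed: the expression evaluates to
   q2 * x2 ^+ 2 + r * y ^+ 2 + 1. *)
Definition cost_bound (R : realType) (a q2 r x2 y z p : R) : R :=
  if z == 0 then q2 * x2 ^+ 2
  else q2 * (1 / z - 1) * (x2 - a * p) ^+ 2 + q2 * x2 ^+ 2 + z
       + r * y ^+ 2 / z.

Definition split_bounds (R : realType) (a l1 u1 l2 u2 x1 x2 z p : R) : Prop :=
  [/\ l1 <= p <= u1,
      (x1 - u1 * z) / (1 - z) <= p <= (x1 - l1 * z) / (1 - z),
      l2 <= a * p <= u2 &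
      (x2 - u2 * z) / (1 - z) <= a * p <= (x2 - l2 * z) / (1 - z)].

(* All the conditions on p are void at z = 1, where they would involve division
   by 1 - z = 0: they stand for conditions on (1 - z) * p, which vanishes. *)
Definition extended_system (R : realType)
    (a l1 u1 l2 u2 q2 r x1 x2 y z w p : R) : Prop :=
  cost_bound a q2 r x2 y z p <= w /\
  (z != 1 -> split_bounds a l1 u1 l2 u2 x1 x2 z p).

(* Main.v *)
Require Import Defs.
From mathcomp Require Import all_boot all_order all_algebra.
From mathcomp Require Import boolp classical_sets reals convex.
From mathcomp Require Import interval_inference ring lra.

(** Fixing the mode z splits Z1 into two convex slices, and the convex hull of
    a union of two nonempty convex sets A and B consists of the points
    (1 - s) x + s y with x in A, y in B and s in [0, 1]; since one slice may
    be empty, [convex_hull_setU] also keeps A and B themselves.  A point of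
    the hull has z = s, so the endpoints z = 0 and z = 1 are the slices
    themselves, and for 0 < z < 1 the content is an elimination of x and y.

    In mode 0 the point x is determined, up to its epigraph coordinate, by its
    first coordinate p: its control vanishes and its second coordinate is a p.
    Given v and p, the mode-1 point is then forced to be
      y = (v - (1 - z) x) / z,
    and its bounds, multiplied by z, become the quotient bounds on p and a p;
    the constant ones are the bounds of mode 0.  The cheapest epigraph
    coordinate of such a decomposition is the mixture of the costs of the two
    modes, and the identity [cost_bound_conv] says that this is the cost bound
    with 1 / z.  The two directions of the elimination are [slices_split] and
    [slices_mix]. *)

Import Order.TTheory GRing.Theory Num.Theory.
Local Open Scope classical_set_scope.
Local Open Scope ring_scope.

(** * Convex hull of a union of two convex sets *)

Lemma convex_setE (R : numDomainType) (M : lmodType R) (A : set M) :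
  @convex_set R M A <->
  forall x y t, 0 <= t <= 1 -> A x -> A y -> A (t *: x + (1 - t) *: y).
Proof.
split=> [cA x y t /andP[t0 t1] Ax Ay | cA x y t].
  have := cA x y (Itv01 t0 t1); rewrite !inE => /(_ Ax Ay); exact.
rewrite !inE => Ax Ay; apply: cA => //.
by apply/andP; split; [exact: ge0 | exact: le1].
Qed.

Lemma convex_convex_hull (R : numDomainType) (M : lmodType R) (A : set M) :
  @convex_set R M (convex_hull A).
Proof.
apply/convex_setE => x y t t01 Ax Ay C [cC AC].
by move/convex_setE: (cC); apply => //; [exact: Ax | exact: Ay].
Qed.

(** The homogenization of A is the cone over A placed at height 1.  The apex
    is included by hand so that it is never empty: this lets a point of A be
    a sum of a point over A and one over B even when B is empty. *)
Definition homogenization {R : numDomainType} {M : lmodType R} (A : set M)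
    (s : R) (u : M) : Prop :=
  (s = 0 /\ u = 0) \/ (0 < s /\ exists2 x, A x & u = s *: x).

Lemma homogenizationD (R : numFieldType) (M : lmodType R) (A : set M) s t u v :
  @convex_set R M A ->
  homogenization A s u -> homogenization A t v ->
  homogenization A (s + t) (u + v).
Proof.
move=> /convex_setE cA [[-> ->]|[s0 [x Ax ->]]]; first by rewrite !add0r.
case=> [[-> ->]|[t0 [y Ay ->]]].
  by rewrite !addr0; right; split=> //; exists x.
have st0 : 0 < s + t by rewrite addr_gt0.
right; split=> //; exists ((s / (s + t)) *: x + (1 - s / (s + t)) *: y).
  apply: cA => //; apply/andP; split; first by rewrite divr_ge0 ?ltW.
  by rewrite ler_pdivrMr// mul1r lerDl ltW.
have st_neq0 := lt0r_neq0 st0.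
rewrite scalerDr !scalerA mulrCA divff// mulr1; congr (_ + _ *: _).
by rewrite mulrBr mulr1 mulrCA divff// mulr1 addrAC subrr add0r.
Qed.

Lemma homogenizationZ (R : numDomainType) (M : lmodType R) (A : set M) k s u :
  0 <= k -> homogenization A s u -> homogenization A (k * s) (k *: u).
Proof.
rewrite le_eqVlt => /orP[/eqP <- _|k0]; first by rewrite mul0r scale0r; left.
case=> [[-> ->]|[s0 [x Ax ->]]]; first by rewrite mulr0 scaler0; left.
by right; split; [rewrite mulr_gt0 | exists x; rewrite ?scalerA].
Qed.

(** Convexity of the right-hand side is immediate on homogenizations, where it
    is additivity and positive homogeneity, and involves no division. *)
Lemma convex_hull_setU (R : numFieldType) (M : lmodType R) (A B : set M) :
  @convex_set R M A -> @convex_set R M B ->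
  convex_hull (A `|` B) =
  [set v | [\/ A v, B v |
     exists s x y, [/\ 0 < s < 1, A x, B y & v = (1 - s) *: x + s *: y]]].
Proof.
move=> cA cB.
pose J := [set v | exists s u w,
  [/\ homogenization A (1 - s) u, homogenization B s w & v = u + w]].
have cJ : @convex_set R M J.
  apply/convex_setE => x x' t /andP[t0 t1].
  move=> [s [u [w [Au Bw ->]]]] [s' [u' [w' [Au' Bw' ->]]]].
  have t1' : 0 <= 1 - t by rewrite subr_ge0.
  exists (t * s + (1 - t) * s'), (t *: u + (1 - t) *: u'), (t *: w + (1 - t) *: w').
  split; last by rewrite !scalerDr addrACA.
    have -> : 1 - (t * s + (1 - t) * s') = t * (1 - s) + (1 - t) * (1 - s').
      by ring.
    by apply: homogenizationD => //; exact: homogenizationZ.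
  by apply: homogenizationD => //; exact: homogenizationZ.
apply/seteqP; split=> v.
  have sJ : A `|` B `<=` J.
    move=> x [Ax|Bx].
      exists 0, x, 0; rewrite subr0 addr0; split=> //; last by left.
      by right; split=> //; exists x; rewrite ?scale1r.
    exists 1, 0, x; rewrite subrr add0r; split=> //; first by left.
    by right; split=> //; exists x; rewrite ?scale1r.
  move=> /(smallest_sub cJ sJ)[s [u [w [[[s1 ->]|[s1 [x Ax ->]]]]]]].
    have {s1}-> : s = 1 by apply/esym/eqP; rewrite -subr_eq0 s1.
    case=> [[/eqP]|[_ [y By ->]]]; first by rewrite oner_eq0.
    by rewrite add0r scale1r => ->; constructor 2.
  case=> [[-> ->]|[s0 [y By ->]]].
    by rewrite subr0 scale1r addr0 => ->; constructor 1.
  move=> ->; constructor 3; exists s, x, y; split=> //.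
  by rewrite s0 -subr_gt0.
have sub : A `|` B `<=` convex_hull (A `|` B) := @sub_gen_smallest _ _ _.
case=> [Av|Bv|[s [x [y [/andP[s0 s1] Ax By ->]]]]].
- by apply: sub; left.
- by apply: sub; right.
- rewrite addrC; have /convex_setE := @convex_convex_hull R M (A `|` B).
  apply; first by rewrite !ltW.
  + by apply: sub; right.
  + by apply: sub; left.
Qed.

(** * The slices of constant mode *)

Lemma sqr_convex (R : realDomainType) (t x y : R) :
  0 <= t <= 1 ->
  (t * x + (1 - t) * y) ^+ 2 <= t * x ^+ 2 + (1 - t) * y ^+ 2.
Proof.
move=> /andP[t0 t1]; rewrite -subr_ge0.
have -> : t * x ^+ 2 + (1 - t) * y ^+ 2 - (t * x + (1 - t) * y) ^+ 2 =
  t * (1 - t) * (x - y) ^+ 2 by ring.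
by rewrite mulr_ge0 ?sqr_ge0// mulr_ge0 ?subr_ge0.
Qed.

Lemma ler_conv (R : realDomainType) (t x x' y y' : R) :
  0 <= t <= 1 -> x <= x' -> y <= y' ->
  t * x + (1 - t) * y <= t * x' + (1 - t) * y'.
Proof.
by move=> /andP[t0 t1] xx yy; rewrite lerD// ler_wpM2l// subr_ge0.
Qed.

Section hull.
Set Implicit Arguments.
Unset Strict Implicit.
Variables (R : realType) (a b c g h l1 u1 l2 u2 q2 r : R).
Hypotheses (hq2 : 0 <= q2) (hr : 0 <= r).

Let sys := system1 a b c g h l1 u1 l2 u2 q2 r.
Let sysv (v : 'rV[R]_5) := sys (v 0 0) (v 0 1) (v 0 2) (v 0 3) (v 0 4).

(** All constraints are affine, except an upper bound on the quadratic
    q2 x2^2 + r y^2, which is convex because q2 and r are nonnegative. *)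
Lemma system1_convex : @convex_set R 'rV[R]_5 sysv.
Proof.
apply/convex_setE => v v' t t01; rewrite /sysv !mxE.
move: (v 0 0) (v 0 1) (v 0 2) (v 0 3) (v 0 4) => x1 x2 y z w.
move: (v' 0 0) (v' 0 1) (v' 0 2) (v' 0 3) (v' 0 4) => x1' x2' y' z' w'.
move=> [cost dyn /andP[g1 h1] /andP[la ua] /andP[lb ub]].
move=> [cost' dyn' /andP[g1' h1'] /andP[la' ua'] /andP[lb' ub']].
have mix := @ler_conv R t _ _ _ _ t01.
split.
- have := ler_wpM2l hq2 (@sqr_convex R t x2 x2' t01).
  have := ler_wpM2l hr (@sqr_convex R t y y' t01).
  have := mix _ _ _ _ cost cost'; lra.
- by rewrite dyn dyn'; ring.
- by apply/andP; split; [have := mix _ _ _ _ g1 g1' | have := mix _ _ _ _ h1 h1']; lra.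
- by apply/andP; split; [have := mix _ _ _ _ la la' | have := mix _ _ _ _ ua ua']; lra.
- by apply/andP; split; [have := mix _ _ _ _ lb lb' | have := mix _ _ _ _ ub ub']; lra.
Qed.

Definition slice (k : R) : set 'rV[R]_5 :=
  [set v : 'rV[R]_5 | v 0 3 = k /\ sysv v].

Lemma slice_convex k : @convex_set R 'rV[R]_5 (slice k).
Proof.
apply/convex_setE => v v' t t01 [vk sv] [vk' sv'].
have /convex_setE cS := system1_convex.
by split; [rewrite !mxE vk vk'; ring | exact: cS].
Qed.

Lemma Z1_slices : Z1 a b c g h l1 u1 l2 u2 q2 r = slice 0 `|` slice 1.
Proof.
apply/seteqP; split=> v; first by move=> [[?|?] ?]; [left|right].
by move=> [[? ?]|[? ?]]; split=> //; [left|right].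
Qed.

(** * Mixing and splitting the two modes *)

(** Here a p and d are the values of x2 in the two modes.  The mean of their
    squares is the square of their mean x2 plus their variance
    z (1 - z) (d - a p)^2, and the term with 1 / z - 1 is that variance, since
    x2 - a p = z (d - a p). *)
Lemma cost_bound_conv z p d y : z != 0 ->
  cost_bound a q2 r ((1 - z) * (a * p) + z * d) (z * y) z p =
  (1 - z) * (q2 * (a * p) ^+ 2) + z * (q2 * d ^+ 2 + r * y ^+ 2 + 1).
Proof.
by move=> z0; rewrite /cost_bound (negbTE z0); field.
Qed.

Lemma system1_mode0 x1 x2 y w : sys x1 x2 y 0 w ->
  [/\ y = 0, x2 = a * x1, q2 * x2 ^+ 2 <= w, l1 <= x1 <= u1 & l2 <= x2 <= u2].
Proof.
case=> cost dyn; rewrite !mulr0 => y0 b1 b2.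
have {}y0 : y = 0 by apply/le_anti; rewrite andbC.
by split=> //; [move: dyn | move: cost]; rewrite y0 => ?; lra.
Qed.

Lemma slices_mix z (v0 v1 : 'rV[R]_5) : 0 < z < 1 -> slice 0 v0 -> slice 1 v1 ->
  let v := (1 - z) *: v0 + z *: v1 in
  [/\ v 0 3 = z, sysv v &
      extended_system a l1 u1 l2 u2 q2 r (v 0 0) (v 0 1) (v 0 2) z (v 0 4)
        (v0 0 0)].
Proof.
move=> /andP[z0 z1] [m0 s0] [m1 s1] v; split.
- by rewrite !mxE m0 m1; ring.
- have /convex_setE := system1_convex; rewrite /v addrC; apply=> //.
  by rewrite !ltW.
have {}z1 : 0 < 1 - z by rewrite subr_gt0.
move: s0 s1; rewrite /sysv m0 m1 => /system1_mode0[y0 x20 w0 b1 b2].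
move=> [w1 dyn _ b1' b2']; rewrite /v !mxE y0; split.
  rewrite mulr0 add0r x20 cost_bound_conv ?gt_eqF//.
  by apply: lerD; rewrite ler_pM2l// -x20.
move=> _; rewrite /split_bounds -x20.
(* Once 1 - z is cleared, the mode-0 part of the mixture cancels and a bound
   on z d remains. *)
have split_le q d l u : l <= d <= u ->
    ((1 - z) * q + z * d - u * z) / (1 - z) <= q <=
    ((1 - z) * q + z * d - l * z) / (1 - z).
  move=> /andP[ld du]; rewrite ler_pdivrMr// ler_pdivlMr//.
  by have := ler_wpM2l (ltW z0) ld; have := ler_wpM2l (ltW z0) du; lra.
by split=> //; exact: split_le.
Qed.

Definition row5 (x1 x2 y z w : R) : 'rV[R]_5 :=
  \row_(j < 5) nth 0 [:: x1; x2; y; z; w] j.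

Lemma row5E x1 x2 y z w (v := row5 x1 x2 y z w) :
  [/\ v 0 0 = x1, v 0 1 = x2, v 0 2 = y, v 0 3 = z & v 0 4 = w].
Proof. by rewrite /v; split; rewrite mxE. Qed.

Lemma row5_eta (v : 'rV[R]_5) :
  v = row5 (v 0 0) (v 0 1) (v 0 2) (v 0 3) (v 0 4).
Proof.
apply/rowP => j; rewrite mxE.
by case: j => [[|[|[|[|[|//]]]]] j5] /=; congr (v _ _); apply/val_inj.
Qed.

Lemma row5_conv s t x1 x2 y z w x1' x2' y' z' w' :
  s *: row5 x1 x2 y z w + t *: row5 x1' x2' y' z' w' =
  row5 (s * x1 + t * x1') (s * x2 + t * x2') (s * y + t * y')
       (s * z + t * z') (s * w + t * w').
Proof.
by apply/rowP => j; rewrite !mxE; case: j => [[|[|[|[|[|//]]]]] j5].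
Qed.

Lemma slices_split x1 x2 y z w p : 0 < z < 1 -> sys x1 x2 y z w ->
  extended_system a l1 u1 l2 u2 q2 r x1 x2 y z w p ->
  exists v0 v1, [/\ slice 0 v0, slice 1 v1 &
    row5 x1 x2 y z w = (1 - z) *: v0 + z *: v1].
Proof.
move=> /andP[z0 z1] [_ dyn /andP[gy yh] _ _] [cost].
rewrite lt_eqF// => /(_ isT)[bp bx bap bx2].
have {}z1 : 0 < 1 - z by rewrite subr_gt0.
have zn0 := lt0r_neq0 z0.
(* The mode-0 point takes the least epigraph coordinate, leaving the most
   room for that of the mode-1 point. *)
pose w0 := q2 * (a * p) ^+ 2.
pose X1 := (x1 - (1 - z) * p) / z.
pose X2 := (x2 - (1 - z) * (a * p)) / z.
pose Y := y / z.
pose W := (w - (1 - z) * w0) / z.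
have eX1 : x1 = (1 - z) * p + z * X1 by rewrite /X1; field.
have eX2 : x2 = (1 - z) * (a * p) + z * X2 by rewrite /X2; field.
have eY : y = z * Y by rewrite /Y; field.
have eW : w = (1 - z) * w0 + z * W by rewrite /W; field.
exists (row5 p (a * p) 0 0 w0), (row5 X1 X2 Y 1 W); split.
- rewrite /slice /= /sysv; have [-> -> -> -> ->] := row5E p (a * p) 0 0 w0.
  split=> //; split=> //; last by rewrite !mulr0 lexx.
    by rewrite /w0 expr0n mulr0 !addr0.
  by rewrite !mulr0 !addr0.
- rewrite /slice /= /sysv; have [-> -> -> -> ->] := row5E X1 X2 Y 1 W.
  split=> //.
  have bounds q x X l u : x = (1 - z) * q + z * X ->
      (x - u * z) / (1 - z) <= q <= (x - l * z) / (1 - z) -> l <= X <= u.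
    move=> ->; rewrite ler_pdivrMr// ler_pdivlMr// => /andP[lo hi].
    by rewrite -(ler_pM2l z0 l) -(ler_pM2l z0 X); lra.
  split.
  + move: cost; rewrite eX2 eY eW cost_bound_conv// lerD2l.
    by rewrite ler_pM2l.
  + by rewrite /X1 /X2 /Y dyn; field.
  + by rewrite !mulr1 /Y ler_pdivlMr// ler_pdivrMr// gy yh.
  + exact: bounds eX1 bx.
  + exact: bounds eX2 bx2.
- by rewrite row5_conv -eX1 -eX2 -eW !mulr0 mulr1 !add0r -eY.
Qed.

End hull.

Theorem proposition1 (R : realType) (a b c g h l1 u1 l2 u2 q2 r : R)
    (hq2 : 0 <= q2) (hr : 0 <= r) :
  convex_hull (Z1 a b c g h l1 u1 l2 u2 q2 r) =
  [set v : 'rV[R]_5 |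
    [/\ 0 <= v 0 3 <= 1,
        system1 a b c g h l1 u1 l2 u2 q2 r
          (v 0 0) (v 0 1) (v 0 2) (v 0 3) (v 0 4) &
        exists p : R,
          extended_system a l1 u1 l2 u2 q2 r
            (v 0 0) (v 0 1) (v 0 2) (v 0 3) (v 0 4) p]].
Proof.
rewrite Z1_slices convex_hull_setU; [|exact: slice_convex..].
apply/seteqP; split=> v.
  case=> [[m s]|[m s]|[z [v0 [v1 [z01 s0 s1 ->]]]]].
  - split=> //; first by rewrite m lexx ler01.
    exists (v 0 0); move: s; rewrite m => /system1_mode0[_ x2E cost b1 b2].
    split; first by rewrite /cost_bound eqxx.
    by rewrite /split_bounds -x2E !mulr0 !subr0 !divr1 !lexx.
  - split=> //; first by rewrite m lexx ler01.
    exists 0; move: s; rewrite m => -[cost _ _ _ _].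
    split; last by rewrite eqxx.
    by rewrite /cost_bound oner_eq0; move: cost; rewrite !divr1; lra.
  - have [vz sv ext] := slices_mix hq2 hr z01 s0 s1.
    split=> //; last by exists (v0 0 0); rewrite vz.
    by rewrite vz; case/andP: z01 => ? ?; rewrite !ltW.
case=> z01 sv [p ext].
have [z0|z0] := eqVneq (v 0 3) 0; first by constructor 1.
have [z1|z1] := eqVneq (v 0 3) 1; first by constructor 2.
have {z0 z1}z01 : 0 < v 0 3 < 1.
  by case/andP: z01 => z_ge z_le; rewrite !lt_def z0 z_ge eq_sym z1.
have [v0 [v1 [s0 s1 e]]] := slices_split z01 sv ext.
by constructor 3; exists (v 0 3), v0, v1; split=> //; rewrite -e -row5_eta.
Qed.
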